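(* Let $R$ be a commutative ring with $1 \neq 0$, $U \subseteq R$ a multiplicative set, and $I$ an ideal of $R$. Then the set of primes $V(I) \cap \operatorname{Spec}(U^{-1}R)$, viewed as a subset of $\operatorname{Spec} R$, satisfies prime avoidance.
   Context: $\operatorname{Spec} R$ is the set of prime ideals of $R$, and $V(I) := \{\mathfrak{p} \in \operatorname{Spec} R \mid I \subseteq \mathfrak{p}\}$. $\operatorname{Spec}(U^{-1}R)$ is viewed inside $\operatorname{Spec} R$ as $\{\mathfrak{p} \in \operatorname{Spec} R \mid \mathfrak{p} \cap U = \emptyset\}$. Prime avoidance: a set $\Lambda \subseteq \operatorname{Spec} R$ satisfies prime avoidance if for every ideal $J$ of $R$, $J \subseteq \bigcup_{\mathfrak{p} \in \Lambda} \mathfrak{p}$ implies $J \subseteq \mathfrak{p}$ for some $\mathfrak{p} \in \Lambda$. *)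

(* Defs.v *)
From mathcomp Require Import all_boot all_order all_algebra.
From mathcomp Require Import boolp classical_sets.

Set Implicit Arguments.
Unset Strict Implicit.
Unset Printing Implicit Defensive.

Import GRing.Theory.

Local Open Scope classical_set_scope.
Local Open Scope ring_scope.

(* An ideal is an R-submodule of R itself (R^o).  Unlike [idealr_closed] of
   ring_quotient, this allows the unit ideal. *)
Definition is_ideal (R : comNzRingType) (I : set R) : Prop :=
  GRing.submod_closed ([in I] : {pred R^o}).

(* [idealr_closed] includes properness, 1 \notin p. *)
Definition Spec (R : comNzRingType) : set (set R) :=
  [set p | idealr_closed [in p] /\ prime_idealr_closed [in p]].
Arguments Spec : clear implicits.

Definition zero_locus (R : comNzRingType) (I : set R) : set (set R) :=
  [set p | Spec R p /\ I `<=` p].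

(* A multiplicative set contains 1. *)
Definition multiplicative_set (R : comNzRingType) (U : set R) : Prop :=
  GRing.mulr_closed [in U].

(* Spec (U^-1 R), identified with its image in Spec R. *)
Definition Spec_localization (R : comNzRingType) (U : set R) : set (set R) :=
  [set p | Spec R p /\ p `&` U = set0].

Definition prime_avoidance (R : comNzRingType) (L : set (set R)) : Prop :=
  L `<=` Spec R /\
  forall J : set R, is_ideal J ->
    J `<=` \bigcup_(p in L) p -> exists2 p, L p & J `<=` p.

(* Main.v *)
(** If [J] lies in the union of the primes that contain [I] and miss [U], then
    [I + J] misses [U]: were [i + j] in [U], the prime of the family containing
    [j] would also contain [i + j].  By Krull's theorem some prime contains
    [I + J] and misses [U]; it belongs to the family and contains [J]. *)
Require Import Defs.
From mathcomp Require Import all_boot all_order all_algebra.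
From mathcomp Require Import boolp classical_sets.

Local Open Scope classical_set_scope.

Import GRing.Theory.

(** Trades the boolean membership of [[in I]] for [Prop] membership, in which sums and unions of
    ideals are handled below. *)
Lemma is_idealP (R : comNzRingType) (I : set R) :
  is_ideal I <-> I 0%R /\ forall a u v, I u -> I v -> I (a * u + v)%R.
Proof.
split=> -[I0 IL]; split.
- exact: set_mem I0.
- by move=> a u v Iu Iv; apply: set_mem (IL a u v (mem_set Iu) (mem_set Iv)).
- exact: mem_set I0.
- move=> a u v Iu Iv; apply: mem_set.
  exact: IL a u v (set_mem Iu) (set_mem Iv).
Qed.

Section IdealTheory.
Set Implicit Arguments.
Unset Strict Implicit.
Context {R : comNzRingType}.
Implicit Types (I J K M U p : set R).

Lemma ideal0 I : is_ideal I -> I 0%R.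
Proof. by case/is_idealP. Qed.

Lemma idealD I u v : is_ideal I -> I u -> I v -> I (u + v)%R.
Proof. by case/is_idealP=> _ IL Iu Iv; rewrite -[u]mul1r; apply: IL. Qed.

Lemma idealMl I a u : is_ideal I -> I u -> I (a * u)%R.
Proof. by case/is_idealP=> I0 IL Iu; rewrite -[(a * u)%R]addr0; apply: IL. Qed.

Definition ideal_add I J : set R := [set (i + j)%R | i in I & j in J].

Lemma ideal_add_ideal I J : is_ideal I -> is_ideal J -> is_ideal (ideal_add I J).
Proof.
move=> hI hJ; apply/is_idealP; split.
  by exists 0%R; [exact: ideal0|exists 0%R; [exact: ideal0|rewrite addr0]].
move=> a _ _ [i Ii [j Jj <-]] [i' Ii' [j' Jj' <-]].
exists (a * i + i')%R; first by apply: idealD => //; exact: idealMl.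
exists (a * j + j')%R; first by apply: idealD => //; exact: idealMl.
by rewrite mulrDr addrACA.
Qed.

Lemma sub_ideal_addl I J : is_ideal J -> I `<=` ideal_add I J.
Proof.
by move=> hJ x Ix; exists x => //; exists 0%R; rewrite ?addr0//; exact: ideal0.
Qed.

Lemma sub_ideal_addr I J : is_ideal I -> J `<=` ideal_add I J.
Proof.
by move=> hI x Jx; exists 0%R; [exact: ideal0|exists x; rewrite ?add0r].
Qed.

Definition principal_ideal (x : R) : set R := range (fun a => (a * x)%R).

Lemma principal_ideal_ideal x : is_ideal (principal_ideal x).
Proof.
apply/is_idealP; split; first by exists 0%R; rewrite ?mul0r.
by move=> a _ _ [b _ <-] [c _ <-]; exists (a * b + c)%R; rewrite // mulrDl mulrA.
Qed.

Lemma Spec_ideal p : Spec R p -> is_ideal p.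
Proof. by case=> -[p0 _ pL] _; split. Qed.

(** By Zorn's lemma: the union of a nonempty chain of ideals missing [U] is again such an ideal,
    since any two of its elements lie in a common member. *)
Lemma exists_maximal_ideal_disjoint K U : is_ideal K -> K `&` U = set0 ->
  exists M, [/\ is_ideal M, K `<=` M, M `&` U = set0 &
    forall N, is_ideal N -> M `<=` N -> N `&` U = set0 -> N `<=` M].
Proof.
move=> hK KU.
(* [K `|` A] rather than [A], since [Zorn_bigcup] includes the empty chain. *)
pose P A := is_ideal (K `|` A) /\ (K `|` A) `&` U = set0.
have [F FP Ftot|A [[hA AU] Amax]] := @Zorn_bigcup R P.
  split; last first.
    rewrite -subset0 => x [[Kx|[X FX Xx]] Ux]; first by rewrite -KU.
    by have [_ <-] := FP _ FX; split=> //; right.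
  apply/is_idealP; split; first by left; exact: ideal0.
  (* Unless [u] and [v] both lie in [K], one member [X] of the chain suffices: [K] is part of every
     [K] ∪ [X], and two members are comparable. *)
  have FL X a u v : F X -> (K `|` X) u -> (K `|` X) v ->
      (K `|` \bigcup_(X in F) X) (a * u + v)%R.
    move=> FX Xu Xv; have [/is_idealP[_ XL] _] := FP _ FX.
    by have [Kx|Xx] := XL a u v Xu Xv; [left|right; exists X].
  move=> a u v [Ku|[X FX Xu]] [Kv|[Y FY Yv]].
  - by left; apply: idealD => //; exact: idealMl.
  - by apply: FL FY _ _; [left|right].
  - by apply: FL FX _ _; [right|left].
  - have [XY|YX] := Ftot _ _ FX FY.
      by apply: FL FY _ _; right => //; exact: XY.
    by apply: FL FX _ _; right => //; exact: YX.
(* Zorn's maximality concerns [A], not [K] ∪ [A]. Since [K] ∪ [N] is [N], [P N] holds; were [N] not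
   inside [K] ∪ [A], it would strictly contain [A]. *)
exists (K `|` A); split => // N hN; rewrite subUset => -[KN AN] NU.
apply: contrapT => NA; apply: (Amax N); last by rewrite /P (setUidr KN).
by split=> // NleA; apply: NA; apply: subset_trans NleA _; exact: subsetUr.
Qed.

(** An ideal [M] maximal among those containing [K] and missing [U] is prime: if [u] and [v] lie
    outside [M], then [M + Ru] and [M + Rv] both meet [U]. The product of the two elements found
    lies in [U], and would lie in [M] if [u * v] did. *)
Lemma exists_prime_disjoint K U : multiplicative_set U -> is_ideal K ->
  K `&` U = set0 -> exists2 p, Spec R p & K `<=` p /\ p `&` U = set0.
Proof.
move=> [U1 UM] hK KU.
have [M [hM KM MU Mmax]] := exists_maximal_ideal_disjoint hK KU.
(* If [M + Rx] missed [U], maximality would put it inside [M], and [x] with it. *)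
have M_meet x : ~ M x -> exists m a, M m /\ U (m + a * x)%R.
  move=> Mx; have hx := principal_ideal_ideal x.
  have /eqP/set0P[_ [[m Mm [_ [a _ <-] <-]] Ux]] :
      ideal_add M (principal_ideal x) `&` U <> set0.
    move=> MxU; apply: Mx; apply: (Mmax _ _ _ MxU).
    - exact: ideal_add_ideal.
    - exact: sub_ideal_addl.
    - by apply: sub_ideal_addr => //; exists 1%R; rewrite ?mul1r.
  by exists m, a.
exists M; last by [].
split; first split; [exact: hM.1 | | exact: hM.2 | ].
  (* [M] is proper because [U] contains 1. *)
  apply/negP=> /set_mem M1; have : (M `&` U) 1%R by split=> //; exact: set_mem U1.
  by rewrite MU.
move=> u v /set_mem Muv; apply/orP; apply: contrapT => /not_orP[Mu Mv].
have [m [a [Mm Uu]]] : exists m a, M m /\ U (m + a * u)%R.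
  by apply: M_meet => Mu'; apply: Mu; exact: mem_set.
have [n [b [Mn Uv]]] : exists m a, M m /\ U (m + a * v)%R.
  by apply: M_meet => Mv'; apply: Mv; exact: mem_set.
suff : (M `&` U) ((m + a * u) * (n + b * v))%R by rewrite MU.
split; last exact: set_mem (UM _ _ (mem_set Uu) (mem_set Uv)).
(* Grouped so that each summand is a multiple of [m], [n] or [u * v], all in [M]. *)
have -> : ((m + a * u) * (n + b * v) =
    (n + b * v) * m + (a * u * n + a * b * (u * v)))%R.
  by rewrite mulrDl [(a * u * (_ + _))%R]mulrDr mulrACA [(m * _)%R]mulrC.
by do 2?[apply: idealD => //]; exact: idealMl.
Qed.

End IdealTheory.

Theorem corollary3 (R : comNzRingType) (U : set R) (I : set R)
    (hU : multiplicative_set U) (hI : is_ideal I) :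
  prime_avoidance (zero_locus I `&` Spec_localization U).
Proof.
split=> [p [[]]//|J hJ Jsub].
have IJU : ideal_add I J `&` U = set0.
  rewrite -subset0 => _ [[i Ii [j Jj <-]] Uij].
  (* [p] is chosen for [j] alone; it contains [i] because every prime of the family contains [I]. *)
  have [p [[pS Ip] [_ pU]] pj] := Jsub j Jj.
  rewrite -pU; split=> //; apply: idealD pj; [exact: Spec_ideal|exact: Ip].
have [p pS [IJp pU]] := exists_prime_disjoint hU (ideal_add_ideal hI hJ) IJU.
exists p; last exact: subset_trans (sub_ideal_addr hI) IJp.
by split; split=> //; exact: subset_trans (sub_ideal_addl hJ) IJp.
Qed.
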